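(* Let $d\ge 2$. There exists $p_{\mathrm M}=p_{\mathrm M}(d)<1$ such that, for $p_{\mathrm M}<p<1$ and $\epsilon>0$, $$\exp\bigl(-\lambda n^{1/(d-1)}\bigr)\le\mathbb P_p(|S_0|>n)\le\exp\bigl(-\gamma n^{1/(d-1)-\epsilon}\bigr),\qquad n\ge 1,$$ where $\lambda=\lambda(d,p)$ and $\gamma=\gamma(d,p,\epsilon)$ are positive and finite. If $d\ne 3$, then these bounds hold even with $\epsilon=0$.
   Context: Let $\mathbb Z^+=\{1,2,\dots\}$ and let $\|\cdot\|$ be the $\ell^1$-norm. Site percolation on $\mathbb Z^d$ with parameter $p\in[0,1]$: each site is independently open with probability $p$ and closed otherwise; the law is $\mathbb P_p$. A function $F:\mathbb Z^{d-1}\to\mathbb Z^+$ is Lipschitz if $|F(x)-F(y)|\le 1$ for all $x,y\in\mathbb Z^{d-1}$ with $\|x-y\|=1$; it is called open if, for each $x\in\mathbb Z^{d-1}$, the site $(x,F(x))\in\mathbb Z^d$ is open. If an open Lipschitz function exists, the pointwise minimum of all of them is itself an open Lipschitz function, called the lowest open Lipschitz function $F$; if none exists, one sets $F(x)=\infty$ for all $x$. By definition $F\ge 1$. With $F$ the lowest open Lipschitz function, $S$ is the set of all $x\in\mathbb Z^{d-1}$ with $F(x)>1$, and $S_0$ is the vertex-set of the connected component containing $0$ in the subgraph of the nearest-neighbour lattice of $\mathbb Z^{d-1}$ induced by $S$ (with $S_0:=\varnothing$ if $0\notin S$). *)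

(* Defs.v *)
From HB Require Import structures.
From mathcomp Require Import all_boot all_order all_algebra.
From mathcomp Require Import all_classical all_reals all_analysis.

Set Implicit Arguments.
Unset Strict Implicit.
Unset Printing Implicit Defensive.

Import Order.TTheory GRing.Theory Num.Theory.

Local Open Scope classical_set_scope.
Local Open Scope ring_scope.

Definition l1norm (m : nat) (x : 'rV[int]_m) : int := \sum_(i < m) `|x 0 i|.

Definition adjacent (m : nat) (x y : 'rV[int]_m) : bool := l1norm (x - y) == 1.

(* The vertex set of the component of x in the subgraph induced by A; it is
   empty when x is not in A, since the path x :: s must lie in A. *)
Definition component (m : nat) (A : set 'rV[int]_m) (x : 'rV[int]_m) :
    set 'rV[int]_m :=
  [set y | exists s : seq 'rV[int]_m,
    [/\ path (@adjacent m) x s, last x s = y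
      & forall z, z \in x :: s -> A z]].

Definition mutually_independent disp (T : measurableType disp) (R : realType)
    (P : probability T R) (I : eqType) (E : I -> set T) : Prop :=
  forall s : seq I, uniq s ->
    P (\bigcap_(i in [set` s]) E i) = (\prod_(i <- s) P (E i))%E.

(* A configuration: w z = true means that the site z is open. *)
Definition config (d : nat) : Type := 'rV[int]_d -> bool.

(* Under P, the random configuration w has the law of site percolation on Z^d
   with parameter p. *)
Definition site_percolation (R : realType) (d : nat) (p : R)
    disp (T : measurableType disp) (P : probability T R)
    (w : T -> config d) : Prop :=
  [/\ forall z, measurable [set t | w t z],
      forall z, P [set t | w t z] = p%:E
    & mutually_independent P (fun z => [set t | w t z])].

(* The site (x, k) of Z^d: for i : 'I_d, [insub] returns the coordinate of x
   with the same index when i < d - 1, and None for the last coordinate. *)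
Definition site (d : nat) (x : 'rV[int]_d.-1) (k : nat) : 'rV[int]_d :=
  \row_(i < d) oapp (fun j : 'I_d.-1 => x 0 j) k%:Z (insub (val i)).

Definition lipschitz (d : nat) (F : 'rV[int]_d.-1 -> nat) : Prop :=
  (forall x, (0 < F x)%N) /\
  (forall x y, l1norm (x - y) = 1 -> `|(F x)%:Z - (F y)%:Z| <= 1).

Definition open_lipschitz (d : nat) (w : config d)
    (F : 'rV[int]_d.-1 -> nat) : Prop :=
  lipschitz F /\ forall x, w (site x (F x)).

(* The pointwise minimum; +oo when there is no open Lipschitz function, as the
   infimum of the empty set. *)
Definition lowest (R : realType) (d : nat) (w : config d)
    (x : 'rV[int]_d.-1) : \bar R :=
  ereal_inf [set (F x)%:R%:E | F in open_lipschitz w].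

(* The set S of the sites of Z^(d-1) where the lowest function exceeds 1. *)
Definition above1 (R : realType) (d : nat) (w : config d) : set 'rV[int]_d.-1 :=
  [set x | (1%:E < lowest R w x)%E].

(* The component S_0 of 0 in S. *)
Definition S0 (R : realType) (d : nat) (w : config d) : set 'rV[int]_d.-1 :=
  component (above1 R w) 0.

(* #|A| > n, for a possibly infinite set A. *)
Definition card_gt (T : Type) (A : set T) (n : nat) : Prop :=
  (`I_n.+1 #<= A)%card.

(* Main.v *)
Require Import Defs.
From HB Require Import structures.
From mathcomp Require Import all_boot all_order all_algebra.
From mathcomp Require Import all_classical all_reals all_analysis.
From mathcomp Require Import zify ring lra.

Import Order.TTheory GRing.Theory Num.Theory.
Import Defs.

Local Open Scope classical_set_scope.
Local Open Scope ring_scope.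

(** Write m = d - 1 and q = 1 - p, and call (x, k) reachable when it can be
    reached from height 0 by unit steps up onto closed sites and free steps
    that go down by one, either vertically or to a neighbouring column. Every
    open Lipschitz function lies strictly above the reachable sites, and where
    these are bounded the lowest one is their upper boundary, so x belongs to S
    exactly when (x, 1) is reachable ([above1E]). This replaces an infimum over
    functions by the existence of a finite path, which also makes the events
    measurable.

    Lower bound. If the m k + 1 sites above the origin are all closed, then
    every z with l1norm at most m k belongs to S, hence to S_0. This ball
    contains the box of the (k + 1)^m points with coordinates in 0, ..., k, so
    with k the integer part of n^(1/m) the event has probability at least
    q^(m k + 1) ([prob_card_gt_ge]).

    Upper bound. If S_0 has more than n sites, one of them, y, has a coordinate
    of order n^(1/m), so it suffices that the radius of S_0 has an exponential
    tail. A path from 0 to y in S gives a zigzag: run backwards along a path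
    that reaches (0, 1) until height 0, run forwards from there back up to
    (0, 1), pass to the next point of S, and so on until (y, 1). Reflect the
    forward parts through height 0, a point at height h becoming a point at
    height -h. The zigzag becomes a walk in Z^m x Z from (0, 1) to (y, -1) in
    a single directed graph, whose edges either rise by one, freely, or fall by
    one, which requires some site to be closed ([component_linked]). Now
    - a walk between two states can be made simple, and each site is
      responsible for falls out of at most two states, one in each half;
    - the walk falls by 2 in total, so more than half of its steps are falls.
    Hence a walk of N steps exhibits at least N / 4 distinct closed sites
    ([linked_walls]). There are at most D^N candidate walks, where D depends
    only on m, so their total probability is at most (D q^(1/4))^N, and N is at
    least the size of the coordinates of y. For q small this sums to the
    exponential bound of [prob_card_gt_le].

    Working with the radius rather than with the volume gives the exponent
    1/m for every d, including d = 3; since n >= 1, the bounds with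
    epsilon > 0 follow from the one with epsilon = 0. *)

(** * Geometry of the lattice *)

Lemma l1norm_ge0 m (x : 'rV[int]_m) : 0 <= l1norm x.
Proof. exact: sumr_ge0. Qed.

Lemma l1normN m (x : 'rV[int]_m) : l1norm (- x) = l1norm x.
Proof. by apply: eq_bigr => i _; rewrite mxE normrN. Qed.

Lemma adjacent_sym m (x y : 'rV[int]_m) : adjacent x y = adjacent y x.
Proof. by rewrite /adjacent -l1normN opprB. Qed.

Lemma l1norm_coord m (x : 'rV[int]_m) i : `|x 0 i| <= l1norm x.
Proof. by rewrite /l1norm (bigD1 i) //= lerDl sumr_ge0. Qed.

Lemma l1norm_eq0 m (x : 'rV[int]_m) : (l1norm x == 0) = (x == 0).
Proof.
apply/eqP/eqP => [x0|->]; last first.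
  by rewrite /l1norm big1 // => i _; rewrite mxE normr0.
apply/rowP => i; rewrite mxE; apply/eqP.
by rewrite -normr_le0 -x0 l1norm_coord.
Qed.

Lemma l1norm0 m : l1norm (0 : 'rV[int]_m) = 0.
Proof. by apply/eqP; rewrite l1norm_eq0. Qed.

(** Moving the i-th coordinate towards 0 shortens the vector, whatever nonzero
    coordinate is chosen. Both the Lipschitz decay of reachable heights and the
    connectedness of balls are inductions along such steps. *)
Lemma exists_closer m (x : 'rV[int]_m) : x != 0 ->
  exists2 x', adjacent x' x & l1norm x = l1norm x' + 1.
Proof.
move=> x0; have [i xi0] : exists i, x 0 i != 0.
  apply/existsP; apply: contraR x0; rewrite negb_exists => /forallP x0.
  by apply/eqP/rowP => i; have := x0 i; rewrite negbK mxE => /eqP.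
pose x' := \row_j (if j == i then x 0 i - Num.sg (x 0 i) else x 0 j).
exists x'.
  rewrite /adjacent /l1norm (bigD1 i) //= big1 => [|j /negPf ji].
    by rewrite !mxE eqxx addrAC subrr add0r normrN addr0 normr_sg xi0.
  by rewrite !mxE ji subrr normr0.
rewrite /l1norm (bigD1 i) //= [in RHS](bigD1 i) //=.
rewrite [in RHS](eq_bigr (fun j => `|x 0 j|)) => [|j /negPf ji]; last first.
  by rewrite mxE ji.
have xi1 : 1 <= `|x 0 i| by rewrite -gtz0_ge1 normr_gt0.
rewrite mxE eqxx {2}[x 0 i]numEsg -{2}[Num.sg _]mulr1 -mulrBr normrM normr_sg.
by rewrite xi0 mul1r ger0_norm ?subr_ge0 // addrAC subrK.
Qed.

Lemma site_inj m (x x' : 'rV[int]_m) k k' :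
  @site m.+1 x k = @site m.+1 x' k' -> x = x' /\ k = k'.
Proof.
move=> /rowP e; split.
  apply/rowP => j; have := e (widen_ord (leqnSn m) j).
  by rewrite !mxE (valK j : insub (val (widen_ord (leqnSn m) j)) = Some j).
have := e ord_max; rewrite !mxE /= insubF ?ltnn //= => /eqP.
by rewrite eqz_nat => /eqP.
Qed.

(** * Reachable heights *)

Section Reach.
Context {m : nat}.
Implicit Types (x y : 'rV[int]_m) (w : config m.+1).

(** The steps are read from their end point, and [n] bounds the length of the
    path; recursion on [n] instead of an inductive predicate lets measurability
    be proved by induction as well. *)
Fixpoint reach w n x k : Prop :=
  if n is n'.+1 then
    [/\ (0 < k)%N, ~~ w (@site m.+1 x k) & reach w n' x k.-1] \/
    (exists2 x', (x' == x) || adjacent x' x & reach w n' x' k.+1)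
  else k = 0%N.

Definition reachable w x k := exists n, reach w n x k.

Lemma reachable0 w x : reachable w x 0.
Proof. by exists 0%N. Qed.

Lemma reachable_closed w x k :
  ~~ w (@site m.+1 x k.+1) -> reachable w x k -> reachable w x k.+1.
Proof. by move=> wx [n rn]; exists n.+1; left. Qed.

Lemma reachable_down w x x' k : (x' == x) || adjacent x' x ->
  reachable w x' k.+1 -> reachable w x k.
Proof. by move=> xx [n rn]; exists n.+1; right; exists x'. Qed.

Lemma reachable_le w x k j : (j <= k)%N -> reachable w x k -> reachable w x j.
Proof.
elim: k => [|k IH]; first by rewrite leqn0 => /eqP->.
rewrite leq_eqVlt => /orP[/eqP-> //|jk rk]; apply: IH => //.
by apply: reachable_down rk; rewrite eqxx.
Qed.

(** Diagonal steps down are free, so reachable heights decay at most linearly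
    with the distance. *)
Lemma reachable_far w x y k j : l1norm (x - y) = j%:Z ->
  reachable w x (k + j) -> reachable w y k.
Proof.
elim: j x => [|j IH] x.
  by move/eqP; rewrite l1norm_eq0 subr_eq0 addn0 => /eqP->.
move=> xy; have [|x' ax' xx'] := @exists_closer m (x - y).
  by rewrite -l1norm_eq0 xy.
rewrite addnS => /(@reachable_down _ (x' + y)) r; apply: (IH (x' + y)).
  by rewrite addrK; lia.
apply: r; apply/orP; right; rewrite adjacent_sym.
by move: ax'; rewrite /adjacent opprB addrA addrAC.
Qed.

(** An open Lipschitz function stays above a path of allowed steps: a step up
    cannot land on its graph, as it lands on a closed site, and a step down to a
    neighbour is at least as steep as the graph. *)
Lemma reachable_lt w F x k : open_lipschitz w F -> reachable w x k ->
  (k < F x)%N.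
Proof.
move=> [[F0 Fl] Fo] [n]; elim: n x k => [|n IH] x k /=; first by move->.
case=> [[k0 wk /IH kF]|[x' /orP[/eqP->|]]].
- have : k != F x by apply: contraNneq wk => ->; exact: Fo.
  by move: k0 kF; lia.
- by move/IH; lia.
- by move=> /eqP/Fl Fxx /IH; lia.
Qed.

(** The function is the boundary of the reachable set. Reachable heights are
    finite everywhere once (y, 1) is unreachable, since a site at height
    1 + l1norm (x - y) above x would reach (y, 1); the steps up make the
    boundary open, the diagonal steps down make it Lipschitz. *)
Lemma unreachable_open_lipschitz w y : ~ reachable w y 1 ->
  exists2 F, open_lipschitz w F & F y = 1%N.
Proof.
move=> y1.
have unr x : exists k, `[< ~ reachable w x k >].
  exists (1 + `|l1norm (x - y)|)%N; apply/asboolP => /reachable_far.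
  by move/(_ y) => r; apply/y1/r; have := l1norm_ge0 _ (x - y); lia.
pose F x := ex_minn (unr x).
have FN x : ~ reachable w x (F x).
  by rewrite /F; case: ex_minnP => k /asboolP.
have Fm x k : ~ reachable w x k -> (F x <= k)%N.
  by move=> /asboolP rk; rewrite /F; case: ex_minnP => j _; exact.
have F0 x : (0 < F x)%N.
  rewrite lt0n; apply/eqP => Fx; apply: (FN x); rewrite Fx.
  exact: reachable0.
have Fp x : reachable w x (F x).-1.
  by apply: contrapT => /Fm; have := F0 x; lia.
exists F; last by apply/eqP; rewrite eqn_leq F0 Fm.
have Fle x x' : l1norm (x - x') = 1 -> (F x <= (F x').+1)%N.
  move=> xx'; apply: Fm => r; apply: (FN x').
  by apply: reachable_down r; rewrite /adjacent xx' eqxx orbT.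
split; [split=> // x x' xx'|move=> x].
  have := Fle _ _ xx'; have := Fle x' x.
  by rewrite -[l1norm (x' - x)]l1normN opprB => /(_ xx'); lia.
apply/negPn/negP => wx; apply: (FN x).
by move: wx (Fp x); rewrite -(prednK (F0 x)); exact: reachable_closed.
Qed.

Lemma above1E (R : realType) w x : above1 R w x <-> reachable w x 1.
Proof.
rewrite /above1 /=; split => [lw|r].
  apply: contrapT => /unreachable_open_lipschitz[F oF Fx].
  move: lw; rewrite ltNge => /negP; apply.
  by apply: ereal_inf_lbound; exists F => //; rewrite Fx.
apply: (@lt_le_trans _ _ 2%:E); first by rewrite lte_fin ltr1n.
apply: le_ereal_inf_tmp => _ [F oF <-]; rewrite lee_fin ler_nat.
exact: reachable_lt oF r.
Qed.

End Reach.

(** * The reflected walk *)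

Section Walk.
Context {m : nat}.
Implicit Types (x y : 'rV[int]_m) (w : config m.+1).

Definition state : Type := 'rV[int]_m * int.

(** The site that must be closed for a walk to fall from [s]. At a height h > 0
    the walk follows a path backwards and undoes a step up that landed at h. At
    h <= 0 it follows a path forwards, reflected: the real height is -h and the
    step up lands at 1 - h. *)
Definition mirror (s : state) : 'rV[int]_m.+1 :=
  @site m.+1 s.1 (if 0 < s.2 then `|s.2|%N else `|1 - s.2|%N).

(** [None] is the fall; [Some v] rises and shifts each coordinate by -1, 0 or 1,
    a superset of the lateral displacements of length at most 1 that is easier
    to enumerate. *)
Definition move : Type := option {ffun 'I_m -> 'I_3}.

Definition act (s : state) (a : move) : state :=
  if a is Some v then (s.1 + \row_i ((v i)%:Z - 1), s.2 + 1)
  else (s.1, s.2 - 1).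

Definition edge w : rel state := fun s s' =>
  [exists a : move, (act s a == s') && ((a == None) ==> ~~ w (mirror s))].

Definition linked w (s s' : state) :=
  exists2 p, path (edge w) s p & last s p = s'.

Lemma linked_trans w s1 s2 s3 : linked w s1 s2 -> linked w s2 s3 ->
  linked w s1 s3.
Proof.
move=> [p wp <-] [q wq <-]; exists (p ++ q); last by rewrite last_cat.
by rewrite cat_path wp.
Qed.

Lemma linked_fall w x (h : int) : ~~ w (mirror (x, h)) ->
  linked w (x, h) (x, h - 1).
Proof.
move=> wx; exists [:: (x, h - 1)] => //=; rewrite andbT.
by apply/existsP; exists None; rewrite /= !eqxx.
Qed.

Lemma linked_rise w x x' (h : int) : (x' == x) || adjacent x' x ->
  linked w (x, h) (x', h + 1).
Proof.
move=> xx'; exists [:: (x', h + 1)] => //=; rewrite andbT; apply/existsP.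
have x1 i : `|(x' - x) 0 i| <= 1.
  apply: (le_trans (l1norm_coord _ _ _)).
  by case/orP: xx' => [/eqP->|/eqP->//]; rewrite subrr l1norm0.
exists (Some [ffun i => inord (absz ((x' - x) 0 i + 1))]).
rewrite andbT /= xpair_eqE eqxx andbT.
apply/eqP/rowP => i; rewrite !mxE ffunE inordK; move: (x1 i);
  by rewrite !mxE; move: (x 0 i) (x' 0 i) => a b; lia.
Qed.

(** A path from (x0, 0) to (x, k), followed backwards and then, after
    reflection, forwards. *)
Lemma reach_linked w n x k : reach w n x k -> exists x0,
  linked w (x, k%:Z) (x0, 0) /\ linked w (x0, 0) (x, - k%:Z).
Proof.
elim: n x k => [|n IH] x k /=.
  by move->; exists x; split; exists [::].
case=> [[]|[x' xx' /IH[x0 [up down]]]]; last first.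
  exists x0; split.
    apply: linked_trans up; have -> : k.+1%:Z = k%:Z + 1 by lia.
    exact: linked_rise.
  apply: linked_trans down _.
  have -> : - k%:Z = - k.+1%:Z + 1 by lia.
  by apply: linked_rise; rewrite eq_sym adjacent_sym.
case: k => // k _ wx /= /IH[x0 [up down]]; exists x0; split.
  apply: linked_trans up.
  have -> : k%:Z = k.+1%:Z - 1 by lia.
  exact: linked_fall.
apply: linked_trans down _.
have -> : - k.+1%:Z = - k%:Z - 1 by lia.
apply: linked_fall; rewrite /mirror /=.
case: ifP => [|_]; first lia.
by have -> : `|1 - - k%:Z|%N = k.+1 by lia.
Qed.

(** The passage from the end (x, -1) of one zigzag to the start (x', 1) of the
    next consists of two free rises: (x, 1) to (x, 0) followed forwards, then
    (x', 1) to (x, 0) followed backwards. *)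
Lemma component_linked w (A : set 'rV[int]_m) x y :
  (forall z, A z -> reachable w z 1) -> component A x y ->
  linked w (x, 1) (y, -1).
Proof.
move=> Ar [s [ps <- sA]]; elim: s x ps sA => [|x' s IH] x /=.
  move=> _ /(_ x); rewrite inE eqxx => /(_ isT)/Ar[n /reach_linked[x0 []]].
  exact: linked_trans.
move=> /andP[xx' ps] sA.
have /Ar[n /reach_linked[x0 [up down]]] : A x by apply: sA; rewrite mem_head.
apply: (@linked_trans _ _ (x, -1)); first exact: linked_trans up down.
apply: (@linked_trans _ _ (x, -1 + 1)).
  by apply: linked_rise; rewrite eqxx.
apply: (@linked_trans _ _ (x', -1 + 1 + 1)).
  by apply: linked_rise; rewrite adjacent_sym xx' orbT.
by apply: IH => // z zs; apply: sA; rewrite inE zs orbT.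
Qed.

Fixpoint falls (s : state) (l : seq move) : seq state :=
  if l is a :: l' then
    if a is None then s :: falls (act s a) l' else falls (act s a) l'
  else [::].

Lemma path_moves w s p : path (edge w) s p -> exists2 l,
  scanl act s l = p & all (fun z => ~~ w z) [seq mirror t | t <- falls s l].
Proof.
elim: p s => [|s' p IH] s /=; first by exists [::].
move=> /andP[/existsP[a /andP[/eqP ss' wa]] /IH[l lp wl]].
exists (a :: l); first by rewrite /= ss' lp.
by case: a ss' wa => [v|] /= -> wa //=; rewrite wa.
Qed.

Lemma subseq_falls s l : subseq (falls s l) (s :: scanl act s l).
Proof.
elim: l s => // -[v|] l IH s.
  exact: subseq_trans (IH (act s (Some v))) (subseq_cons _ _).
by rewrite -[falls _ _]/(s :: falls (act s None) l) /= eqxx; apply: IH.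
Qed.

Lemma last_height s l :
  (last s (scanl act s l)).2 = s.2 + (size l)%:Z - (size (falls s l)).*2%:Z.
Proof.
elim: l s => [|a l IH] s /=; first lia.
by rewrite IH; case: a => [v|] /=; lia.
Qed.

Lemma last_coord s l i :
  `|(last s (scanl act s l)).1 0 i - s.1 0 i| <= (size l)%:Z.
Proof.
elim: l s => [|a l IH] s /=; first by rewrite subrr normr0.
have := IH (act s a); move: ((last (act s a) _).1 0 i) => b.
case: a => [v|] /=; rewrite ?mxE; move: (s.1 0 i) => c; last lia.
by have := ltn_ord (v i); lia.
Qed.

(** The heights h > 0 and 1 - h <= 0 are the only ones with the same mirror
    image in a column, and the walk is backwards at one and forwards at the
    other. *)
Lemma mirror_inj_sign (s t : state) : (0 < s.2) = (0 < t.2) ->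
  mirror s = mirror t -> s = t.
Proof.
case: s t => [x h] [y k] /= hk; rewrite /mirror /= => /site_inj[-> e].
by congr pair; move: hk e; case: ifP; case: ifP; lia.
Qed.

Lemma size_undup_mirror (L : seq state) : uniq L ->
  (size L <= (size (undup (map mirror L))).*2)%N.
Proof.
move=> uL; pose f b := [seq mirror s | s <- L & (0 < s.2) == b].
have fL b : (size (f b) <= size (undup (map mirror L)))%N.
  apply: uniq_leq_size => [|z].
    rewrite map_inj_in_uniq ?filter_uniq // => s t.
    rewrite !mem_filter => /andP[/eqP sb _] /andP[/eqP tb _].
    by apply: mirror_inj_sign; rewrite sb tb.
  rewrite mem_undup => /mapP[s]; rewrite mem_filter => /andP[_ sL] ->.
  exact: map_f.
have -> : size L = (size (f true) + size (f false))%N.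
  rewrite !size_map !size_filter.
  rewrite -(count_predC (fun s : state => (0 < s.2) == true)).
  by congr addn; apply: eq_count => s /=; case: (0 < s.2).
by rewrite -addnn leq_add.
Qed.

(** The distinct sites that are closed if the moves [l] can be made from (0, 1);
    they depend on [l] only, so that the walks can be summed over. *)
Definition walls (l : seq move) : seq 'rV[int]_m.+1 :=
  undup (map mirror (falls (0, 1) l)).

(** Shortening the walk makes the falls leave from distinct states. A walk of N
    steps from height 1 to height -1 has N / 2 + 1 falls, and at most two falls
    share a site, whence N <= 4 * size (walls l). *)
Lemma linked_walls w y i : linked w (0, 1) (y, -1) ->
  exists l : seq move, [/\ (absz (y 0%R i) <= size l)%N,
    (size l <= 4 * size (walls l))%N & all (fun z => ~~ w z) (walls l)].
Proof.
move=> [p0 /shortenP[p /path_moves[l <- wl] up _]] e.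
exists l; split.
- by have := last_coord (0, 1) l i; rewrite e mxE; move: (y 0 i) => b /=; lia.
- have := last_height (0, 1) l; rewrite e /=.
  have := size_undup_mirror _ (subseq_uniq (subseq_falls _ _) up).
  by rewrite -/(walls l); move: (size (falls _ _)) (size (walls _)) => a b; lia.
- by rewrite /walls; apply/allP => z; rewrite mem_undup; move/allP: wl; apply.
Qed.

End Walk.

(** * Cardinality *)

(* A point in int, hence in 'rV[int]_m, serves as the default value by which
   an injection out of a subset extends to a total function. *)
HB.instance Definition _ := isPointed.Build int 0.

Lemma card_gtP (T : pointedType) (A : set T) (n : nat) :
  card_gt A n <-> exists s : seq T,
    [/\ uniq s, (n < size s)%N & forall z, z \in s -> A z].
Proof.
split=> [/pcard_leP[f]|[s [us ns sA]]].
  exists [seq f i | i <- iota 0 n.+1]; split.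
  - rewrite map_inj_in_uniq ?iota_uniq // => i j.
    rewrite !mem_iota !add0n => /andP[_ im] /andP[_ jm] fij.
    by apply: (@inj _ _ _ f) => //; rewrite inE.
  - by rewrite size_map size_iota.
  - move=> z /mapP[i]; rewrite mem_iota add0n => /andP[_ im] ->.
    exact: (@funS _ _ _ _ f).
apply/pcard_leP/injfunPex; exists (nth point s) => [i /= im|i j].
  by apply/sA/mem_nth/(leq_trans im).
rewrite !inE /= => im jm /eqP; rewrite nth_uniq //; first by move/eqP.
  exact: leq_trans im ns.
exact: leq_trans jm ns.
Qed.

(** The box of the points with coordinates between -k and k has only
    (2 k + 1)^m elements. *)
Lemma card_gt_far m (A : set 'rV[int]_m) n k : (k.*2.+1 ^ m <= n)%N ->
  card_gt A n -> exists2 y, A y & exists i, (k < absz (y 0%R i))%N.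
Proof.
move=> kn /card_gtP[s [us ns sA]]; apply: contrapT => near.
have {}near (y : 'rV[int]_m) i : y \in s -> (absz (y 0%R i) <= k)%N.
  move=> /sA Ay; rewrite leqNgt; apply/negP => yi.
  by apply: near; exists y => //; exists i.
pose f (y : 'rV[int]_m) : {ffun 'I_m -> 'I_k.*2.+1} :=
  [ffun i => inord (absz (y 0 i + k%:Z))].
have fs : uniq (map f s).
  rewrite map_inj_in_uniq // => y z ys zs /ffunP fyz; apply/rowP => i.
  have := congr1 val (fyz i); have := near y i ys; have := near z i zs.
  rewrite !ffunE; move: (y 0 i) (z 0 i) => a b ha hb.
  by rewrite /= !inordK; lia.
have := max_card (mem (map f s)); rewrite (card_uniqP fs) size_map.
by rewrite card_ffun !card_ord leqNgt (leq_ltn_trans kn ns).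
Qed.

(** The l1-ball of radius m k contains the box of the points with coordinates
    between 0 and k. *)
Lemma card_gt_near m (A : set 'rV[int]_m) n k : (n < k.+1 ^ m)%N ->
  (forall z, l1norm z <= (m * k)%N%:Z -> A z) -> card_gt A n.
Proof.
move=> nk mkA.
pose f (g : {ffun 'I_m -> 'I_k.+1}) : 'rV[int]_m := \row_i (g i)%:Z.
apply/card_gtP; exists [seq f g | g <- enum {ffun 'I_m -> 'I_k.+1}]; split.
- rewrite map_inj_uniq ?enum_uniq // => g h /rowP gh; apply/ffunP => i.
  by apply: val_inj; have := gh i; rewrite !mxE => -[].
- by rewrite size_map -cardE card_ffun !card_ord.
move=> _ /mapP[g _ ->]; apply: mkA.
apply: (@le_trans _ _ (\sum_(i < m) k%:Z)).
  by apply: ler_sum => i _; rewrite mxE; case: (g i) => b; rewrite /=; lia.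
by rewrite sumr_const card_ord; lia.
Qed.

Lemma component_ball m (A : set 'rV[int]_m) (r : int) x :
  (forall z, l1norm z <= r -> A z) -> l1norm x <= r -> component A 0 x.
Proof.
move=> rA; have [j jx] : exists j : nat, l1norm x = j%:Z.
  by exists (absz (l1norm x)); have := l1norm_ge0 _ x; lia.
elim: j x jx => [|j IH] x jx jr.
  exists [::]; split=> // [|z]; first by apply/esym/eqP; rewrite -l1norm_eq0 jx.
  rewrite inE => /eqP->; apply: rA.
  by rewrite l1norm0; lia.
have [|x' xx' e] := exists_closer _ x; first by rewrite -l1norm_eq0 jx.
have [||s [s0 sx' sA]] := IH x'; [lia|lia|].
exists (rcons s x); split; first by rewrite rcons_path s0 sx'.
  by rewrite last_rcons.
move=> z; rewrite -rcons_cons mem_rcons inE => /orP[/eqP->|/sA//].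
exact: rA.
Qed.

(** * Measurability *)

Section MeasurableConnectives.
Context {disp : measure_display} {T : measurableType disp}.

Lemma measurable_exists (I : countType) (Q : I -> T -> Prop) :
  (forall i, measurable [set t | Q i t]) ->
  measurable [set t | exists i, Q i t].
Proof.
move=> mQ; have -> : [set t | exists i, Q i t] = \bigcup_i [set t | Q i t].
  by apply/seteqP; split=> [t [i]|t [i _]]; exists i.
by apply: countable_bigcupT_measurable.
Qed.

Lemma measurable_forall (I : countType) (Q : I -> T -> Prop) :
  (forall i, measurable [set t | Q i t]) ->
  measurable [set t | forall i, Q i t].
Proof.
move=> mQ.
have -> : [set t | forall i, Q i t] = ~` [set t | exists i, ~ Q i t].
  apply/seteqP; split=> t /= => [Qt [i]|Qt i] //.
  by apply: contrapT => nQ; apply: Qt; exists i.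
apply: measurableC; apply: measurable_exists => i.
exact: (measurableC (mQ i)).
Qed.

Lemma measurable_and (Q Q' : T -> Prop) :
  measurable [set t | Q t] -> measurable [set t | Q' t] ->
  measurable [set t | Q t /\ Q' t].
Proof. exact: measurableI. Qed.

Lemma measurable_or (Q Q' : T -> Prop) :
  measurable [set t | Q t] -> measurable [set t | Q' t] ->
  measurable [set t | Q t \/ Q' t].
Proof. exact: measurableU. Qed.

Lemma measurable_prop (B : Prop) : measurable [set _ : T | B].
Proof.
have [b|b] := pselect B.
  by rewrite (_ : [set _ | _] = setT) //; apply/seteqP; split.
by rewrite (_ : [set _ | _] = set0) // -subset0.
Qed.

Lemma measurable_when (B : Prop) (Q : T -> Prop) :
  measurable [set t | Q t] -> measurable [set t | B /\ Q t].
Proof. by move=> mQ; apply: measurableI => //; exact: measurable_prop. Qed.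

End MeasurableConnectives.

Lemma measurable_closed disp (T : measurableType disp) d (w : T -> config d) z :
  measurable [set t | w t z] -> measurable [set t | ~~ w t z].
Proof.
move=> mw.
rewrite (_ : [set t | _] = ~` [set t | w t z]); first exact: measurableC.
by apply/seteqP; split=> t /= /negP.
Qed.

Section Measurability.
Context {R : realType} {m : nat} {disp : measure_display}
  {T : measurableType disp} (w : T -> config m.+1).
Context (mw : forall z, measurable [set t | w t z]).

Lemma measurable_reachable x k : measurable [set t | reachable (w t) x k].
Proof.
apply: measurable_exists => n; elim: n x k => [|n IH] x k /=.
  exact: measurable_prop.
apply: measurable_or.
  rewrite (_ : [set t | _] =
    [set t | (0 < k)%N /\ (~~ w t (@site m.+1 x k) /\ reach (w t) n x k.-1)]).
    apply: measurable_when; apply: measurable_and => //.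
    exact: measurable_closed.
  by apply/seteqP; split=> [t []|t [? []]].
rewrite (_ : [set t | _] = [set t | exists x',
  (x' == x) || adjacent x' x /\ reach (w t) n x' k.+1]).
  by apply: measurable_exists => x'; apply: measurable_when.
by apply/seteqP; split=> [t [x' ? ?]|t [x' [? ?]]]; exists x'.
Qed.

(** Once S is expressed by reachability, the event is a countable combination of
    events on single sites, because finite sequences in Z^m are countable. *)
Lemma measurable_card_gt_S0 n :
  measurable [set t | card_gt (S0 R (w t)) n].
Proof.
rewrite (_ : [set t | _] = [set t | exists s : seq 'rV[int]_m,
  (uniq s && (n < size s)%N) /\ forall y, y \notin s \/ exists l,
    (path (@adjacent m) 0 l /\ last 0 l = y) /\
    forall z, z \notin 0 :: l \/ reachable (w t) z 1]).
  apply: measurable_exists => s; apply: measurable_when.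
  apply: measurable_forall => y; apply: measurable_or.
    exact: measurable_prop.
  apply: measurable_exists => l; apply: measurable_when.
  apply: measurable_forall => z; apply: measurable_or.
    exact: measurable_prop.
  exact: measurable_reachable.
apply/seteqP; split=> t /=.
  move/card_gtP => [s [us ns sS]]; exists s; split; first by rewrite us.
  move=> y; have [/sS[l [pl ly lS]]|?] := boolP (y \in s); [right|by left].
  exists l; split=> // z; have [/lS|?] := boolP (z \in 0 :: l); last by left.
  by move=> /above1E; right.
move=> [s [/andP[us ns] sS]]; apply/card_gtP; exists s; split=> // y ys.
case: (sS y) => [/negP//|[l [[pl ly] lS]]]; exists l; split=> // z zl.
by apply/above1E; case: (lS z) => // /negP.
Qed.

End Measurability.

(** * Independence *)

Section Probability.
Context {R : realType} {d : nat} {p : R} {disp : measure_display}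
  {T : measurableType disp} {P : probability T R} {w : T -> config d}.
Context (perc : site_percolation p P w).

Lemma measurable_open_closed (A B : seq 'rV[int]_d) :
  measurable [set t | all (w t) A && all (fun z => ~~ w t z) B].
Proof.
have [mw _ _] := perc.
have mall (Q : 'rV[int]_d -> T -> bool) (L : seq 'rV[int]_d) :
    (forall z, measurable [set t | Q z t]) ->
    measurable [set t | all (Q^~ t) L].
  move=> mQ; elim: L => [|z L IH] /=.
    by rewrite (_ : [set t | _] = setT) //; apply/seteqP; split.
  rewrite (_ : [set t | _] = [set t | Q z t] `&` [set t | all (Q^~ t) L]).
    exact: measurableI.
  by apply/seteqP; split=> t /= => [/andP|[-> ->]].
rewrite (_ : [set t | _] = [set t | all (w t) A] `&`
  [set t | all (fun z => ~~ w t z) B]).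
  apply: measurableI; first exact: (mall (fun z t => w t z)).
  by apply: (mall (fun z t => ~~ w t z)) => z; exact: measurable_closed.
by apply/seteqP; split=> t /= => [/andP|[-> ->]].
Qed.

(** The independence assumption concerns open sites. A closed site z is handled
    by subtraction: among the configurations open on A and closed on B, those
    with z closed are the complement of those with z open. *)
Lemma prob_open_closed (A B : seq 'rV[int]_d) : uniq (A ++ B) ->
  P [set t | all (w t) A && all (fun z => ~~ w t z) B] =
  (p ^+ size A * (1 - p) ^+ size B)%:E.
Proof.
have [mw pw iw] := perc.
elim: B A => [|z B IH] A.
  rewrite cats0 mulr1 => uA.
  rewrite (_ : [set t | _] = \bigcap_(z in [set` A]) [set t | w t z]).
    rewrite iw // {uA}; elim: A => [|z A IH]; first by rewrite big_nil.
    by rewrite big_cons IH pw /= exprS EFinM.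
  apply/seteqP; split=> t /=; rewrite andbT; last by move=> tA; apply/allP.
  by move=> /allP tA z; exact: tA.
move=> uAzB; have uzAB : uniq ((z :: A) ++ B).
  by move: uAzB; rewrite -[z :: B]cat1s uniq_catCA.
have uAB : uniq (A ++ B) by case/andP: uzAB.
have PzA := IH _ uzAB.
have mzA := measurable_open_closed (z :: A) B.
have mzB := measurable_open_closed A (z :: B).
have : P ([set t | all (w t) A && all (fun z => ~~ w t z) (z :: B)] `|`
  [set t | all (w t) (z :: A) && all (fun z => ~~ w t z) B]) =
  (p ^+ size A * (1 - p) ^+ size B)%:E.
  rewrite -IH //; congr (P _); apply/seteqP; split=> t /=.
    by case=> [/and3P[-> _ ->]|/andP[/andP[_ ->] ->]].
  by move=> /andP[-> ->]; case: (w t z); [right|left].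
rewrite measureU //; last first.
  by rewrite -subset0 => t [/= /and3P[_ /negPf->]].
set X := (X in (X + _)%E); set Y := (X in (_ + X)%E) => XY.
have YE : Y = (p ^+ size (z :: A) * (1 - p) ^+ size B)%:E := PzA.
have XE : X = (X + Y - Y)%E by rewrite addeK // YE.
rewrite -[LHS]/X XE XY YE -EFinB /= !exprS; by congr _%:E; ring.
Qed.

Lemma prob_closed (B : seq 'rV[int]_d) : uniq B ->
  P [set t | all (fun z => ~~ w t z) B] = ((1 - p) ^+ size B)%:E.
Proof. by move=> uB; have := @prob_open_closed [::] B uB; rewrite mul1r. Qed.

End Probability.

Lemma prob_has_le (R : realType) disp (T : measurableType disp)
    (P : probability T R) (I : Type) (s : seq I) (E : I -> T -> bool) (c : R) :
  (forall i, measurable [set t | E i t]) ->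
  (forall i, (P [set t | E i t] <= c%:E)%E) ->
  measurable [set t | has (E^~ t) s] /\
  (P [set t | has (E^~ t) s] <= ((size s)%:R * c)%:E)%E.
Proof.
move=> mE PE; elim: s => [|i s [mIH IH]] /=.
  by rewrite (_ : [set t | _] = set0) ?measure0 ?mul0r // -subset0.
rewrite (_ : [set t | _] = [set t | E i t] `|` [set t | has (E^~ t) s]).
  split; first exact: measurableU.
  apply: le_trans; first exact: measureU2.
  by rewrite -natr1 mulrDl mul1r EFinD addeC; apply: leeD => //; exact: PE.
by apply/seteqP; split=> t /= => [/orP//|[]->//]; rewrite orbT.
Qed.

(** * Tail bounds for the component *)

Section Tail.
Context {R : realType} {m : nat} {p : R} {disp : measure_display}
  {T : measurableType disp} {P : probability T R} {w : T -> config m.+1}.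
Context (perc : site_percolation p P w).

Let D := #|{: @move m}|.

(** A union bound over the walks of k + 1 + j steps, for all j. With
    q <= (4 D)^-4, the at least N / 4 closed sites of a walk of N steps have
    probability at most (4 D)^-N, and there are D^N walks. *)
Lemma prob_card_gt_le n k : 0 <= 1 - p <= (4 * D%:R)^-1 ^+ 4 ->
  (k.*2.+1 ^ m <= n)%N ->
  (P [set t | card_gt (S0 R (w t)) n] <= (2^-1 ^+ k.+1)%:E)%E.
Proof.
move=> /andP[q0 qD] kn; have [mw _ _] := perc.
have D0 : (0 < D)%N by apply/card_gt0P; exists None.
have D0' : D%:R != 0 :> R by rewrite pnatr_eq0 -lt0n.
set r := (4 * D%:R)^-1 in qD.
have r0 : 0 <= r by rewrite invr_ge0 mulr_ge0 // ler0n.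
have r1 : r <= 1.
  by rewrite invf_le1 ?mulr_gt0 ?ltr0n // -natrM ler1n muln_gt0.
pose E N (l : N.-tuple (@move m)) t :=
  (size l <= 4 * size (walls l))%N && all (fun z => ~~ w t z) (walls l).
have mE N l : measurable [set t | E N l t].
  rewrite /E; case: leqP => _ /=; last exact: measurable_prop.
  exact: (measurable_open_closed perc [::]).
have PE N l : (P [set t | E N l t] <= (r ^+ N)%:E)%E.
  rewrite /E; case: leqP => [lw|_] /=; last first.
    rewrite (_ : [set t | _] = set0) ?measure0 ?lee_fin ?exprn_ge0 //.
    by rewrite -subset0.
  rewrite (prob_closed perc) ?undup_uniq // lee_fin.
  rewrite size_tuple in lw.
  apply: (@le_trans _ _ ((r ^+ 4) ^+ size (walls l))).
    by apply: lerXn2r => //; rewrite nnegrE // exprn_ge0.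
  by rewrite -exprM; apply: ler_wiXn2l.
pose F N := [set t | has (E N^~ t) (enum {: N.-tuple (@move m)})].
have [mF PF] : (forall N, measurable (F N)) /\
    (forall N, (P (F N) <= (4^-1 ^+ N)%:E)%E).
  split=> N; have [mF PF] := @prob_has_le _ _ _ P _
    (enum {: N.-tuple (@move m)}) _ _ (mE N) (PE N); first exact: mF.
  move: PF; rewrite -cardE card_tuple natrX -exprMn /r.
  by rewrite invfM mulrC -mulrA mulVf // mulr1.
have sub : [set t | card_gt (S0 R (w t)) n] `<=` \bigcup_j F (k.+1 + j)%N.
  move=> t /= /(card_gt_far _ _ _ _ kn)[y Sy [i kyi]].
  have [l [yl lw wl]] : exists l : seq (@move m),
      [/\ (absz (y 0%R i) <= size l)%N, (size l <= 4 * size (walls l))%N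
        & all (fun z => ~~ w t z) (walls l)].
    apply: linked_walls; apply: component_linked Sy => z.
    by move/above1E.
  have kl : (k.+1 + (size l - k.+1) = size l)%N by lia.
  exists (size l - k.+1)%N => //; rewrite /F kl /=.
  by apply/hasP; exists (in_tuple l); rewrite ?mem_enum // /E /= lw wl.
apply: le_trans.
  apply: (@measure_sigma_subadditive _ _ _ P _ (fun j => F (k.+1 + j)%N)) => //.
  exact: measurable_card_gt_S0.
apply: le_trans (epsilon_trick0 xpredT _); last by rewrite exprn_ge0.
apply: lee_nneseries => // j _; apply: (le_trans (PF _)).
(* 4^-(k+1+j) is split as a factor at most 2^-(k+1) and a factor at most
   2^-(j+1), the terms of a series of sum 1. *)
rewrite lee_fin (_ : 4^-1 = 2^-1 * 2^-1 :> R); last first.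
  by rewrite -invfM -natrM.
rewrite exprMn natrX -exprVn ler_pM ?exprn_ge0 //; apply: ler_wiXn2l.
all: rewrite ?invr_ge0 ?invf_le1 ?ler1n //; lia.
Qed.

(** The closed sites are those above the origin up to height m k + 1, which is
    what it takes for height 1 to be reachable at distance m k. *)
Lemma prob_card_gt_ge n k : (n < k.+1 ^ m)%N ->
  (((1 - p) ^+ (m * k).+1)%:E <= P [set t | card_gt (S0 R (w t)) n])%E.
Proof.
move=> nk; have [mw _ _] := perc.
pose column := [seq @site m.+1 0 i | i <- iota 1 (m * k).+1].
have uc : uniq column.
  by rewrite map_inj_uniq ?iota_uniq // => i j /site_inj[].
have sc : size column = (m * k).+1 by rewrite size_map size_iota.
rewrite -sc -(prob_closed perc _ uc); apply: le_measure; rewrite ?inE.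
- exact: (measurable_open_closed perc [::] column).
- exact: measurable_card_gt_S0.
move=> t tc; have {}tc z : z \in column -> ~~ w t z by move: z; apply/allP.
have rc i : (i <= (m * k).+1)%N -> reachable (w t) 0 i.
  elim: i => [_|i IH im]; first exact: reachable0.
  apply: reachable_closed (IH (ltnW im)); apply: tc.
  by apply: map_f; rewrite mem_iota; lia.
have ball z : l1norm z <= (m * k)%N%:Z -> above1 R (w t) z.
  move=> zmk; apply/above1E; have z0 := l1norm_ge0 _ z.
  apply: (@reachable_far _ _ 0 _ _ (absz (l1norm z))).
    by rewrite sub0r l1normN gez0_abs.
  by apply: rc; rewrite add1n ltnS -lez_nat gez0_abs.
apply: (card_gt_near _ _ _ _ nk) => z zmk; exact: component_ball ball zmk.
Qed.

End Tail.

Theorem theorem4 (R : realType) (d : nat) (hd : (2 <= d)%N) :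
  exists2 pM : R, pM < 1 &
  forall p : R, 0 <= p <= 1 -> pM < p < 1 ->
  exists (lambda : R) (gamma : R -> R),
  [/\ 0 < lambda,
      forall eps : R, 0 <= eps -> 0 < gamma eps
    & forall (disp : measure_display) (T : measurableType disp)
        (P : probability T R) (w : T -> config d),
      site_percolation p P w ->
      forall n : nat, (1 <= n)%N ->
      [/\ ((expR (- (lambda * n%:R `^ (d.-1%:R)^-1)))%:E
             <= P [set t | card_gt (S0 R (w t)) n])%E,
          forall eps : R, 0 < eps ->
            (P [set t | card_gt (S0 R (w t)) n]
             <= (expR (- (gamma eps * n%:R `^ ((d.-1%:R)^-1 - eps))))%:E)%E
        & d <> 3%N ->
            (P [set t | card_gt (S0 R (w t)) n]
             <= (expR (- (gamma 0 * n%:R `^ (d.-1%:R)^-1)))%:E)%E]].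
Proof.
case: d hd => // m; rewrite ltnS => m0.
set D := #|{: @move m}|.
have D0 : (0 < D)%N by apply/card_gt0P; exists None.
set r := (4 * D%:R)^-1 : R.
have r0 : 0 < r by rewrite invr_gt0 mulr_gt0 // ltr0n.
have r1 : r <= 1.
  by rewrite invf_le1 ?mulr_gt0 ?ltr0n // -natrM ler1n muln_gt0.
exists (1 - r ^+ 4); first by rewrite ltrBlDr ltrDl exprn_gt0.
move=> p _ /andP[pM p1]; have q0 : 0 < 1 - p by rewrite subr_gt0.
have p0 : 0 < p.
  by rewrite (le_lt_trans _ pM) // subr_ge0 exprn_ile1 // ltW.
have ln2 : 0 < ln 2 :> R by rewrite ln_gt0 // ltr1n.
have lnq : ln (1 - p) < 0 by rewrite ln_lt0 // q0 gtrBl.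
exists (- (m.+1%:R * ln (1 - p))), (fun=> ln 2 / 3); split.
- by rewrite oppr_gt0 pmulr_rlt0 // ltr0n.
- by move=> _ _; rewrite divr_gt0.
move=> disp T P w perc n n0.
set t := n%:R `^ (m.+1.-1%:R)^-1 : R.
have n1 : 1 <= n%:R :> R by rewrite ler1n.
have tm : t ^+ m = n%:R.
  rewrite -powR_mulrn ?powR_ge0 // -powRrM mulVf ?powRr1 ?ler0n //.
  by rewrite pnatr_eq0 -lt0n.
have t1 : 1 <= t by rewrite -(powRr0 n%:R) ler_powR // invr_ge0 ler0n.
set k := Num.truncn t.
have /andP[kt tk] : k%:R <= t < k.+1%:R by apply: truncn_itv; lra.
have k1 : (0 < k)%N by rewrite truncn_gt0.
have kn : (k ^ m <= n)%N.
  by rewrite -(ler_nat R) natrX -tm lerXn2r // nnegrE ?ler0n //; lra.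
have nk : (n < k.+1 ^ m)%N.
  by rewrite -(ltr_nat R) natrX -tm ltrXn2r // ?nnegrE ?ler0n -?lt0n //; lra.
(* The box of half-width j = (k - 1) / 2 has side 2 j + 1 <= k, and
   j + 1 >= t / 3. *)
have upper : (P [set t | card_gt (S0 R (w t)) n] <=
    (expR (- (ln 2 / 3 * t)))%:E)%E.
  have kn' : ((k.-1)./2.*2.+1 ^ m <= n)%N.
    apply: leq_trans kn; rewrite leq_exp2r //.
    by move: k1; clearbody k; clear; lia.
  apply: le_trans (prob_card_gt_le perc _ _ _ kn') _.
    by rewrite ltW /= -/D -/r; lra.
  rewrite lee_fin -[2^-1]lnK ?posrE ?invr_gt0 // -expRM_natl ler_expR.
  rewrite lnV ?posrE //.
  have tk' : t <= 3 * (k.-1)./2.+1%:R.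
    rewrite (le_trans (ltW tk)) // -natrM ler_nat.
    by move: k1; clearbody k; clear; lia.
  rewrite mulrN lerN2; nra.
split=> [|eps e0|//].
- apply: le_trans (prob_card_gt_ge perc _ _ nk); rewrite lee_fin.
  rewrite -[(1 - p) in leRHS]lnK ?posrE // -expRM_natl ler_expR.
  rewrite mulNr opprK mulrAC ler_nM2r //.
  apply: (@le_trans _ _ (m.+1%:R * k%:R)); last by rewrite ler_pM2l ?ltr0n.
  by rewrite -natrM ler_nat; move: m0 k1; clearbody k; clear; lia.
- apply: le_trans upper _; rewrite lee_fin ler_expR lerN2 ler_pM2l ?divr_gt0 //.
  by apply: ler_powR => //; rewrite gerBl ltW.
Qed.
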